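(* For every error $\delta> 0$ and every height $h\ge 0$, $p^\delta_h\ge (1-2\delta)\,2^{-h}$.
   Context: Decision trees: a deterministic decision tree on $n$ variables adaptively queries input bits and outputs a bit; a randomized decision tree algorithm $A$ is a probability distribution over deterministic decision trees, and it computes $f$ with error at most $\delta$ if $\Pr_{B\sim A}[B(x)\neq f(x)]\le\delta$ for every input $x$. Let $\mathcal{P}^\delta_h$ be the set of randomized decision tree algorithms computing $\mathsf{3\text{-}MAJ}_h$ with error at most $\delta$, where $\mathsf{3\text{-}MAJ}_h:\{0,1\}^{3^h}\to\{0,1\}$ is the recursive majority-of-three function on the complete ternary tree $T_h$ of height $h$ (leaves numbered $1,\dots,3^h$ left to right, each internal node computes the majority of its three children; $\mathsf{3\text{-}MAJ}_0$ is the identity). Hard inputs: $\mathcal{H}_0=\{0,1\}$, and for $h>0$, $\mathcal{H}_h$ is the set of $(x,y,z)\in\mathcal{H}_{h-1}^3$ such that $\mathsf{3\text{-}MAJ}_{h-1}(x),\mathsf{3\text{-}MAJ}_{h-1}(y),\mathsf{3\text{-}MAJ}_{h-1}(z)$ are not all equal. For $x\in\mathcal{H}_h$ the minority path starts at the root of $T_h$ and repeatedly moves to the unique child whose value differs from its parent's value; its leaf is the absolute minority $m(x)\in\{1,\dots,3^h\}$. Define $p^\delta_h=\min_{A\in\mathcal{P}^\delta_h}\Pr_{x\in_R\mathcal{H}_h,\,B\sim A}[B \text{ queries } x_{m(x)} \text{ on input } x]$, with $x$ uniform on $\mathcal{H}_h$. *)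

(* Defs.v *)
From HB Require Import structures.
From mathcomp Require Import all_boot all_order all_algebra.
From mathcomp Require Import all_classical all_reals all_analysis.

Set Implicit Arguments.
Unset Strict Implicit.
Unset Printing Implicit Defensive.

Import Order.TTheory GRing.Theory Num.Theory.
Import numFieldNormedType.Exports.

Local Open Scope classical_set_scope.
Local Open Scope ring_scope.

Notation bits n := {ffun 'I_n -> bool}.

Inductive dtree (n : nat) : Type :=
| Output of bool
| Query of 'I_n & dtree n & dtree n.

Arguments Output {n}.
Arguments Query {n}.

Fixpoint tree_eval n (B : dtree n) (x : bits n) : bool :=
  match B with
  | Output b => b
  | Query i B0 B1 => tree_eval (if x i then B1 else B0) x
  end.

(* The positions of x read by B, in order. *)
Fixpoint queried n (B : dtree n) (x : bits n) : seq 'I_n :=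
  match B with
  | Output _ => [::]
  | Query i B0 B1 => i :: queried (if x i then B1 else B0) x
  end.

(* [dtree n] is a countable type and carries the discrete sigma-algebra, so that a
   probability on it is an arbitrary distribution over deterministic trees. *)
HB.instance Definition _ n := gen_eqMixin (dtree n).
HB.instance Definition _ n := gen_choiceMixin (dtree n).
HB.instance Definition _ n := isPointed.Build (dtree n) (Output false).
HB.instance Definition _ n :=
  @isMeasurable.Build default_measure_display (dtree n)
    (@discrete_measurable (dtree n)) (@discrete_measurable0 (dtree n))
    (@discrete_measurableC (dtree n)) (@discrete_measurableU (dtree n)).

Notation rdtree R n := (probability (dtree n) R).

Definition computes (R : realType) n (A : rdtree R n) (f : bits n -> bool)
    (delta : R) : Prop :=
  forall x, (A [set B | tree_eval B x != f x] <= delta%:E)%E.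

Lemma leaf_subproof h (c : 'I_3) (i : 'I_(3 ^ h)) : (c * 3 ^ h + i < 3 ^ h.+1)%N.
Proof.
rewrite expnS; apply: (@leq_trans (c.+1 * 3 ^ h)%N).
  by rewrite mulSn addnC ltn_add2r.
by rewrite leq_mul2r ltn_ord orbT.
Qed.

(* Position, in the tree of height h.+1, of the leaf i of the c-th subtree of
   the root; leaves are numbered from left to right, starting at 0. *)
Definition subtree_leaf h (c : 'I_3) (i : 'I_(3 ^ h)) : 'I_(3 ^ h.+1) :=
  Ordinal (leaf_subproof c i).

Definition subinput h (x : bits (3 ^ h.+1)) (c : 'I_3) : bits (3 ^ h) :=
  [ffun i => x (subtree_leaf c i)].

Fixpoint maj3 h : bits (3 ^ h) -> bool :=
  match h with
  | 0 => fun x => x ord0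
  | h'.+1 => fun x => (1 < #|[pred c : 'I_3 | maj3 (subinput x c)]|)%N
  end.

Fixpoint hard h : bits (3 ^ h) -> bool :=
  match h with
  | 0 => fun _ => true
  | h'.+1 => fun x =>
      [forall c, hard (subinput x c)] &&
      ~~ [forall c, forall d, maj3 (subinput x c) == maj3 (subinput x d)]
  end.

Definition hard_inputs h : {set bits (3 ^ h)} := [set x | hard x]%SET.

(* The leaf m(x) ending the minority path. On hard inputs the child picked
   exists and is unique; elsewhere the value is irrelevant. *)
Fixpoint abs_minority h : bits (3 ^ h) -> 'I_(3 ^ h) :=
  match h with
  | 0 => fun _ => ord0
  | h'.+1 => fun x =>
      let c := odflt ord0 [pick c | maj3 (subinput x c) != maj3 x] in
      subtree_leaf c (abs_minority (subinput x c))
  end.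

(* Pr[B queries x_m(x) on input x] for independent B ~ A and x uniform on the
   hard inputs. *)
Definition minority_query_prob (R : realType) h (A : rdtree R (3 ^ h)) : R :=
  #|hard_inputs h|%:R^-1 *
  \sum_(x in hard_inputs h) fine (A [set B | abs_minority x \in queried B x]).

Definition minority_query_probs (R : realType) (delta : R) h : set R :=
  [set minority_query_prob A | A in [set A | computes A (@maj3 h) delta]].

(* The infimum is attained, see [p_attained] below. *)
Definition p (R : realType) (delta : R) h : R := inf (minority_query_probs delta h).

Fixpoint query_all n (f : bits n -> bool) (s : seq 'I_n) (y : bits n) : dtree n :=
  match s with
  | [::] => Output (f y)
  | i :: s' =>
      let B b := query_all f s' [ffun j => if j == i then b else y j] in
      Query i (B false) (B true)
  end.

Lemma tree_eval_query_all n f s (x y : bits n) :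
  (forall j, j \notin s -> y j = x j) -> tree_eval (query_all f s y) x = f x.
Proof.
elim: s y => [|i s IH] y yx /=; first by congr f; apply/ffunP => j; exact: yx.
case xi: (x i); apply: IH => j js; rewrite ffunE; case: eqVneq => [->//|ji];
  by apply: yx; rewrite inE negb_or ji.
Qed.

Lemma fine_probability_le1 R n (A : rdtree R n) E : 0 <= fine (A E) <= 1.
Proof.
rewrite fine_ge0 ?measure_ge0//= -lee_fin fineK; first exact: probability_le1.
exact: fin_num_measure.
Qed.

Lemma mixture_exists (R : realType) n N (w : 'rV[R]_N) (t : 'I_N -> dtree n) :
  (forall i, 0 <= w 0 i) -> \sum_i w 0 i = 1 ->
  exists A : rdtree R n, forall E : pred (dtree n),
    A [set B | E B] = (\sum_i w 0 i * (E (t i))%:R)%:E.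
Proof.
move=> w0 w1.
pose m (k : nat) : {measure set (dtree n) -> \bar R} :=
  if insub k is Some i then mscale (NngNum (w0 i)) \d_(t i) else mzero.
have mE (E : pred (dtree n)) :
    msum m N [set B | E B] = (\sum_i w 0 i * (E (t i))%:R)%:E.
  rewrite /msum -sumEFin; apply: eq_bigr => i _.
  rewrite /m valK /= /mscale /= diracE EFinM; congr (_ * _%:R%:E)%E.
  by congr (nat_of_bool _); apply/idP/idP; rewrite inE.
exists (mnormalize (msum m N) (\d_(Output false))) => E.
have mT : msum m N setT = 1%E.
  transitivity (msum m N [set B | predT B]); first by congr msum; rewrite eqEsubset.
  by rewrite mE; congr EFin; rewrite -[RHS]w1; apply: eq_bigr => i _; exact: mulr1.
rewrite /= /mnormalize ifF.
  set e := (X in fine X); rewrite (_ : e = 1%E) //=.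
  by rewrite invr1 mule1 mE.
have eq1 (z : \bar R) : z = 1%E -> (z == 0%E) || (z == +oo%E) = false.
  by move=> ->; rewrite onee_eq0.
exact: eq1 mT.
Qed.

Lemma reps_exist (K : finType) n (ev : K -> pred (dtree n)) :
  exists N (t : 'I_N -> dtree n), forall (R : realType) (A : rdtree R n),
    exists w : 'rV[R]_N, [/\ forall i, 0 <= w 0 i, \sum_i w 0 i = 1 &
      forall k, A [set B | ev k B] = (\sum_i w 0 i * (ev k (t i))%:R)%:E].
Proof.
pose sig B : {ffun K -> bool} := [ffun k => ev k B].
pose S := {ffun K -> bool}.
pose cls (i : 'I_#|S|) := [set B | sig B = enum_val i].
pose t (i : 'I_#|S|) := xget (Output false) (cls i).
exists #|S|, t => R A; exists (\row_i fine (A (cls i))).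
have wE i : (\row_i fine (A (cls i))) 0 i = fine (A (cls i)) by rewrite mxE.
have tc : trivIset setT cls.
  by move=> i j _ _ [B [Bi Bj]]; apply: enum_val_inj; rewrite -(Bi : sig B = _) -(Bj : sig B = _).
have evE (E : {ffun K -> bool} -> bool) :
    A [set B | E (sig B)] = (\sum_i fine (A (cls i)) * (E (sig (t i)))%:R)%:E.
  have -> : [set B | E (sig B)] =
      \big[setU/set0]_(i < #|S| | E (enum_val i)) cls i.
    transitivity (\bigcup_(i in [set` [pred i | E (enum_val i)]]) cls i);
      last exact: bigcup_pred.
    apply/seteqP; split => [B EB | B [i Ei sB]].
      exists (enum_rank (sig B)); last by rewrite /cls /= enum_rankK.
      by rewrite /= inE enum_rankK.
    by change (is_true (E (sig B))); rewrite (sB : sig B = _).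
  rewrite measure_bigsetU_ord // big_mkcond -sumEFin; apply: eq_bigr => i _.
  have [ci|/set0P ci] := eqVneq (cls i) set0.
    have Z : A (cls i) = 0%E by rewrite ci measure0.
    by transitivity (0%E : \bar R); [case: ifP => // _; exact: Z|rewrite Z /= mul0r].
  have st : cls i (t i) := xgetPex (Output false) ci.
   rewrite (st : sig (t i) = _); case: ifP => _; last by rewrite mulr0.
  by rewrite mulr1 fineK // fin_num_measure.
split => [i| |k].
- by rewrite wE; case/andP: (fine_probability_le1 A (cls i)).
- have /= := evE xpredT; rewrite (_ : mkset _ = setT) ?eqEsubset//.
  rewrite probability_setT => -[->].
  by apply: eq_bigr => i _; rewrite wE mulr1.
- have -> : [set B | ev k B] = [set B | sig B k].
    by apply/seteqP; split=> B /=; rewrite ffunE.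
  rewrite (evE (fun g => g k)); congr EFin; apply: eq_bigr => i _.
  by rewrite wE ffunE.
Qed.

Lemma continuous_sumr (R : realType) (T : topologicalType) (K : Type)
    (s : seq K) (P : pred K) (f : K -> T -> R) :
  (forall k, continuous (f k)) -> continuous (fun x => \sum_(k <- s | P k) f k x).
Proof.
move=> cf; elim: s => [|k s IH] x.
  under eq_fun do rewrite big_nil.
  exact: cst_continuous.
under eq_fun do rewrite big_cons.
case: (P k); last exact: IH.
by apply: cvgD; [exact: cf|exact: IH].
Qed.

Lemma continuous_mulr_cst (R : realType) (T : topologicalType) (f : T -> R) a :
  continuous f -> continuous (fun x => f x * a).
Proof. by move=> cf x; apply: cvgMr_tmp; exact: cf. Qed.

Lemma continuous_dot (R : realType) N (a : 'I_N -> R) :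
  continuous (fun w : 'rV[R]_N => \sum_i w 0 i * a i).
Proof.
apply: continuous_sumr => i; apply: continuous_mulr_cst.
exact: coord_continuous.
Qed.

Lemma compact_simplex (R : realType) N (K : finType) (a : K -> 'I_N -> R)
    (delta : R) :
  compact [set w : 'rV[R]_N | [/\ forall i, 0 <= w 0 i, \sum_i w 0 i = 1 &
      forall k, \sum_i w 0 i * a k i <= delta]].
Proof.
apply: (@subclosed_compact _ _
  [set v : 'rV[R]_N | forall i, (`[0, 1]%classic : set R) (v ord0 i)]).
- have -> : [set w : 'rV[R]_N | [/\ forall i, 0 <= w 0 i, \sum_i w 0 i = 1 &
      forall k, \sum_i w 0 i * a k i <= delta]] =
    (\bigcap_i ((fun w : 'rV[R]_N => w 0 i) @^-1` [set x | 0 <= x])) `&`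
    ((fun w : 'rV[R]_N => \sum_i w 0 i * 1) @^-1` [set x | x = 1]) `&`
    (\bigcap_k ((fun w : 'rV[R]_N => \sum_i w 0 i * a k i) @^-1`
                  [set x | x <= delta])).
    apply/seteqP; split => w /=.
      move=> [w0 w1 wk]; split; [split|].
      - by move=> i _; exact: w0.
      - by rewrite /= -[RHS]w1; apply: eq_bigr => i _; rewrite mulr1.
      - by move=> k _; exact: wk.
    move=> [[w0 w1] wk]; split => //.
    - by move=> i; exact: w0.
    - by rewrite -w1; apply: eq_bigr => i _; rewrite mulr1.
    - by move=> k; exact: wk.
  apply: closedI; first apply: closedI.
  + apply: closed_bigI => i _; apply: preimage_closed; last exact: closed_ge.
    by move=> w _; exact: coord_continuous.
  + apply: preimage_closed; last exact: closed_eq.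
    by move=> w _; exact: continuous_dot.
  + apply: closed_bigI => k _; apply: preimage_closed; last exact: closed_le.
    by move=> w _; exact: continuous_dot.
- apply: (@rV_compact _ _ (fun=> `[0, 1]%classic : set R)) => _.
  exact: segment_compact.
- move=> w [w0 w1 _] i /=; rewrite in_itv /= w0 /= -w1 (bigD1 i) //= lerDl.
  by apply: sumr_ge0.
Qed.

Lemma p_attained (R : realType) (delta : R) h : 0 <= delta ->
  minority_query_probs delta h (p delta h) /\
  lbound (minority_query_probs delta h) (p delta h).
Proof.
move=> d0.
pose X := bits (3 ^ h).
pose ev (k : bool * X) (B : dtree (3 ^ h)) :=
  if k.1 then abs_minority k.2 \in queried B k.2 else tree_eval B k.2 != maj3 k.2.
have [N [t Ht]] := reps_exist ev.
pose W : set 'rV[R]_N := [set w : 'rV[R]_N |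
  [/\ forall i, 0 <= w 0 i, \sum_i w 0 i = 1 &
      forall x : X, \sum_i w 0 i * (ev (false, x) (t i))%:R <= delta]].
pose obj (w : 'rV[R]_N) : R := #|hard_inputs h|%:R^-1 *
  \sum_(x in hard_inputs h) \sum_i w 0 i * (ev (true, x) (t i))%:R.
have WA w : W w -> exists2 A : rdtree R (3 ^ h),
    computes A (@maj3 h) delta & minority_query_prob A = obj w.
  move=> [w0 w1 wd]; have [A HA] := mixture_exists t w0 w1; exists A.
    by move=> x; rewrite (HA (ev (false, x))) lee_fin.
  congr (_ * _); apply: eq_bigr => x _.
  by rewrite (HA (ev (true, x))).
have AW (A : rdtree R (3 ^ h)) : computes A (@maj3 h) delta ->
    exists2 w, W w & minority_query_prob A = obj w.
  move=> Ad; have [w [w0 w1 wE]] := Ht R A; exists w.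
    by split=> // x; rewrite -lee_fin -(wE (false, x)); exact: Ad.
  by congr (_ * _); apply: eq_bigr => x _; rewrite (wE (true, x)).
have W0 : W !=set0.
  pose B0 := query_all (@maj3 h) (enum 'I_(3 ^ h)) [ffun=> false].
  suff [w Ww _] : exists2 w, W w &
      minority_query_prob (\d_B0 : rdtree R _) = obj w by exists w.
  apply: AW => x; rewrite /= diracE memNset ?lee_fin//=.
  by rewrite tree_eval_query_all ?eqxx// => j; rewrite mem_enum.
have cW : compact W by exact: compact_simplex.
have cobj : continuous obj.
  rewrite (_ : obj = fun w => (\sum_(x in hard_inputs h)
      \sum_i w 0 i * (ev (true, x) (t i))%:R) * #|hard_inputs h|%:R^-1).
    apply: continuous_mulr_cst; apply: continuous_sumr => x.
    exact: continuous_dot.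
  by apply/funext => w; rewrite mulrC.
have [w wW wmin] := compact_EVT_min W0 cW (continuous_subspaceT cobj).
rewrite inE in wW.
have lb : lbound (minority_query_probs delta h) (obj w).
  by move=> _ [A /= /AW[v Wv ->] <-]; apply: wmin; rewrite inE.
have [A Ad Aw] := WA w wW.
have inw : minority_query_probs delta h (obj w) by exists A.
have -> : p delta h = obj w.
  apply/eqP; rewrite eq_le lb_le_inf ?andbT//; last by exists (obj w).
  by apply: ge_inf => //; exists (obj w).
by split.
Qed.

(* Main.v *)
(** Induction on the height.  Given an algorithm for height h + 1, replace each
    bit b of an input of height h by a uniformly random arrangement of (b, 0, 1)
    in the three leaves below it.  The majority of the triple is b, the encoded
    input is uniform on the hard inputs, and a query of b happens only when the
    position carrying b is queried.  The absolute minority of the encoded input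
    is the entry [~~ b] of the triple that encodes the absolute minority bit of
    the original one.  Exchanging the entries b and [~~ b] in that triple
    changes the input in two positions only, and as the first query to one of
    them is common to both inputs, the position of b is queried at most twice as
    often as that of [~~ b].  Hence each level costs at most a factor 2. *)

Require Import Defs.
From mathcomp Require Import all_boot all_order all_algebra.
From mathcomp Require Import all_classical all_reals all_analysis.
From mathcomp Require Import zify lra.

Set Implicit Arguments.
Unset Strict Implicit.
Unset Printing Implicit Defensive.

Import Order.TTheory GRing.Theory Num.Theory.
Local Open Scope ring_scope.

(** * Majority, minority and codes of triples of bits *)

Definition maj (f : 'I_3 -> bool) : bool := (1 < #|[pred c | f c]|)%N.

Definition minority (f : 'I_3 -> bool) : 'I_3 :=
  odflt ord0 [pick c | f c != maj f].

Definition nonconst (f : 'I_3 -> bool) : bool :=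
  ~~ [forall c, forall d, f c == f d].

Lemma ord3P (P : 'I_3 -> Prop) : P 0 -> P 1 -> P (1 + 1) -> forall c, P c.
Proof.
move=> P0 P1 P2 [[|[|[|//]]] lt_c3].
- by rewrite (_ : Ordinal _ = 0) //; exact: val_inj.
- by rewrite (_ : Ordinal _ = 1) //; exact: val_inj.
- by rewrite (_ : Ordinal _ = 1 + 1) //; exact: val_inj.
Qed.

Lemma big_ord3 (T : Type) (idx : T) (op : Monoid.law idx) (F : 'I_3 -> T) :
  \big[op/idx]_c F c = op (op (F 0) (F 1)) (F (1 + 1)).
Proof.
rewrite !big_ord_recr big_ord0 Monoid.mul1m.
by congr (op (op (F _) (F _)) (F _)); exact: val_inj.
Qed.

Lemma majE f : maj f = (1 < f 0%R + f 1%R + f (1 + 1)%R)%N.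
Proof.
rewrite /maj -sum1_card big_mkcond big_ord3 /= !inE.
by case: (f 0); case: (f 1); case: (f (1 + 1)).
Qed.

Lemma nonconstE f : nonconst f = ~~ ((f 0 == f 1) && (f 1 == f (1 + 1))).
Proof.
congr (~~ _); apply/idP/idP => [/forallP fP|/andP[/eqP f01 /eqP f12]].
  by rewrite (forallP (fP 0)) (forallP (fP 1)).
by apply/forallP; apply: ord3P; apply/forallP; apply: ord3P;
  rewrite ?f01 ?f12 ?eqxx.
Qed.

(** At least two of the three entries agree with the majority, so [pick] has only one candidate. *)
Lemma minority_unique f m : f m != maj f -> minority f = m.
Proof.
rewrite /minority; case: pickP => [c /= fc fm|/(_ m)/negbT/=/negP//].
move: c m fc fm; rewrite majE.
by apply: ord3P; apply: ord3P => //;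
  case: (f 0); case: (f 1); case: (f (1 + 1)).
Qed.

(* [(k, s)] is the arrangement of (b, 0, 1) with b in position k, followed
   cyclically by s and [~~ s]; [None] marks the position of the unknown b. *)
Definition code (e : 'I_3 * bool) (d : 'I_3) : option bool :=
  if d == e.1 then None else Some (if d == e.1 + 1 then e.2 else ~~ e.2).

Definition triple (e : 'I_3 * bool) (b : bool) (d : 'I_3) : bool :=
  odflt b (code e d).

(* The position of the entry [~~ b] of [triple e b]. *)
Definition minpos (b : bool) (e : 'I_3 * bool) : 'I_3 :=
  if b == e.2 then e.1 + (1 + 1) else e.1 + 1.

(** Exchanging the entries [b] and [~~ b] is a transposition of three symbols; it reverses their
    cyclic order, hence the negated sign. *)
Definition swap_code (b : bool) (e : 'I_3 * bool) : 'I_3 * bool :=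
  (minpos b e, ~~ e.2).

Lemma code_eq_None e d : (code e d == None) = (d == e.1).
Proof. by rewrite /code; case: ifP. Qed.

Lemma maj_triple e b : maj (triple e b) = b.
Proof. by case: e; apply: ord3P; case; case: b; rewrite majE. Qed.

Lemma nonconst_triple e b : nonconst (triple e b).
Proof. by case: e; apply: ord3P; case; case: b; rewrite nonconstE. Qed.

Lemma minority_triple e b : minority (triple e b) = minpos b e.
Proof.
apply: minority_unique; rewrite maj_triple.
by case: e; apply: ord3P; case; case: b.
Qed.

Lemma swap_codeK b : involutive (swap_code b).
Proof. by case; apply: ord3P; case; case: b; apply/eqP. Qed.

Lemma minpos_swap b e : minpos b (swap_code b e) = e.1.
Proof. by case: e; apply: ord3P; case; case: b; apply/eqP. Qed.

Lemma triple_swap b e d :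
  d != e.1 -> d != minpos b e -> triple (swap_code b e) b d = triple e b d.
Proof.
by case: e; apply: ord3P; case; case: b; move: d; apply: ord3P.
Qed.

(** Either of the two positions with the majority value may carry [b], and the other two entries
    then fix the sign. That the count does not depend on [f] is what makes encoded inputs
    uniform. *)
Lemma card_triple (f : 'I_3 -> bool) : nonconst f ->
  #|[pred e | [forall d, triple e (maj f) d == f d]]| = 2%N.
Proof.
pose P e := [&& triple e (maj f) 0 == f 0, triple e (maj f) 1 == f 1
              & triple e (maj f) (1 + 1) == f (1 + 1)].
have E e : [forall d, triple e (maj f) d == f d] = P e.
  apply/forallP/and3P => [fP|[f0 f1 f2]]; first by split; apply: fP.
  exact: ord3P.
rewrite nonconstE (eq_card E) -sum1_card big_mkcond /=.
rewrite -(pair_bigA _ (fun k s => if P (k, s) then 1%N else 0%N)) //=.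
rewrite big_ord3 !big_bool /P majE.
by case: (f 0); case: (f 1); case: (f (1 + 1)).
Qed.

(** * Substitution in decision trees, and runs on two nearby inputs *)

Fixpoint dtree_subst n m (f : 'I_n -> 'I_m) (c : 'I_n -> option bool)
    (B : dtree n) : dtree m :=
  match B with
  | Output b => Output b
  | Query j B0 B1 =>
      if c j is Some b then dtree_subst f c (if b then B1 else B0)
      else Query (f j) (dtree_subst f c B0) (dtree_subst f c B1)
  end.

Definition bits_subst n m (f : 'I_n -> 'I_m) (c : 'I_n -> option bool)
    (x : bits m) : bits n :=
  [ffun j => odflt (x (f j)) (c j)].

Lemma tree_eval_subst n m (f : 'I_n -> 'I_m) c B x :
  tree_eval (dtree_subst f c B) x = tree_eval B (bits_subst f c x).
Proof.
elim: B => //= j B0 IH0 B1 IH1; rewrite ffunE.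
by case: (c j) => [[]|] //=; case: (x (f j)).
Qed.

Lemma queried_subst n m (f : 'I_n -> 'I_m) c B x :
  queried (dtree_subst f c B) x =
  [seq f j | j <- queried B (bits_subst f c x) & c j == None].
Proof.
elim: B => //= j B0 IH0 B1 IH1; rewrite ffunE.
by case: (c j) => [[]|] //=; case: (x (f j)); rewrite ?IH0 ?IH1.
Qed.

(** Both runs coincide up to the first query of [j] or [k], which is therefore made in both. If
    there is none, the third case keeps only what bounds the left side of [queried_swap_le]. *)
Lemma queried_diff2 n (B : dtree n) (x y : bits n) j k :
  (forall i, i != j -> i != k -> x i = y i) ->
  [\/ j \in queried B x /\ j \in queried B y,
      k \in queried B x /\ k \in queried B y |
      (k \notin queried B x) && (j \notin queried B y)].
Proof.
move=> xy; elim: B => [b|i B0 IH0 B1 IH1] /=; first exact: Or33.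
have [->|ij] := eqVneq i j; first by apply: Or31; rewrite !mem_head.
have [->|ik] := eqVneq i k; first by apply: Or32; rewrite !mem_head.
rewrite !inE ![_ == i]eq_sym (negPf ij) (negPf ik) /= xy //.
by case: (y i).
Qed.

(** This is the source of the factor 2: a common query makes the right side at least 2, and without
    one the left side is 0. *)
Lemma queried_swap_le n (B : dtree n) (x y : bits n) j k :
  (forall i, i != j -> i != k -> x i = y i) ->
  ((k \in queried B x) + (j \in queried B y) <=
   2 * ((j \in queried B x) + (k \in queried B y)))%N.
Proof.
move=> xy; case: (queried_diff2 B xy) =>
  [[-> ->]|[-> ->]|/andP[/negPf-> /negPf->]] //; by do 2 case: (_ \in _).
Qed.

(** * Blocks of three sibling leaves and their contraction *)

Lemma bottom_leaf_subproof h (i : 'I_(3 ^ h)) (c : 'I_3) :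
  (3 * i + c < 3 ^ h.+1)%N.
Proof. by have := ltn_ord i; have := ltn_ord c; rewrite expnS; lia. Qed.

Definition bottom_leaf h (i : 'I_(3 ^ h)) (c : 'I_3) : 'I_(3 ^ h.+1) :=
  Ordinal (bottom_leaf_subproof i c).

Lemma parent_subproof h (j : 'I_(3 ^ h.+1)) : (j %/ 3 < 3 ^ h)%N.
Proof. by rewrite ltn_divLR // -expnSr. Qed.

Definition parent h (j : 'I_(3 ^ h.+1)) : 'I_(3 ^ h) :=
  Ordinal (parent_subproof j).

Definition position h (j : 'I_(3 ^ h.+1)) : 'I_3 := inZp j.

Lemma parent_bottom_leaf h (i : 'I_(3 ^ h)) c : parent (bottom_leaf i c) = i.
Proof. by apply: val_inj => /=; have := ltn_ord c; lia. Qed.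

Lemma position_bottom_leaf h (i : 'I_(3 ^ h)) c :
  position (bottom_leaf i c) = c.
Proof. by apply: val_inj => /=; have := ltn_ord c; lia. Qed.

Lemma bottom_leafK h (j : 'I_(3 ^ h.+1)) :
  bottom_leaf (parent j) (position j) = j.
Proof. by apply: val_inj => /=; lia. Qed.

Lemma subtree_leaf_surj h (j : 'I_(3 ^ h.+1)) :
  exists c i, j = subtree_leaf c i.
Proof.
have p0 : (0 < 3 ^ h)%N by rewrite expn_gt0.
have lc : (j %/ 3 ^ h < 3)%N by rewrite ltn_divLR // -expnS.
have li : (j %% 3 ^ h < 3 ^ h)%N by rewrite ltn_mod.
exists (Ordinal lc), (Ordinal li); apply: val_inj => /=; exact: divn_eq.
Qed.

(** Leaves split both at the root and at the bottom level. Commutation of the two splittings carries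
    recursions from the root over to bottom blocks. *)
Lemma bottom_subtree_leaf h c (i : 'I_(3 ^ h)) d :
  bottom_leaf (subtree_leaf c i) d = subtree_leaf c (bottom_leaf i d).
Proof. by apply: val_inj; rewrite /= expnS; lia. Qed.

Definition block h (y : bits (3 ^ h.+1)) (i : 'I_(3 ^ h)) (c : 'I_3) : bool :=
  y (bottom_leaf i c).

Definition contract h (y : bits (3 ^ h.+1)) : bits (3 ^ h) :=
  [ffun i => maj (block y i)].

Lemma block_subinput h (y : bits (3 ^ h.+2)) c i :
  block (subinput y c) i = block y (subtree_leaf c i).
Proof. by apply/funext => d; rewrite /block ffunE bottom_subtree_leaf. Qed.

Lemma contract_subinput h (y : bits (3 ^ h.+2)) c :
  contract (subinput y c) = subinput (contract y) c.
Proof. by apply/ffunP => i; rewrite !ffunE block_subinput. Qed.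

Lemma maj3S h (x : bits (3 ^ h.+1)) :
  maj3 x = maj (fun c => maj3 (subinput x c)).
Proof. by []. Qed.

Lemma hardS h (x : bits (3 ^ h.+1)) :
  hard x = [forall c, hard (subinput x c)] &&
           nonconst (fun c => maj3 (subinput x c)).
Proof. by []. Qed.

Lemma abs_minorityS h (x : bits (3 ^ h.+1)) :
  abs_minority x =
  subtree_leaf (minority (fun c => maj3 (subinput x c)))
    (abs_minority (subinput x (minority (fun c => maj3 (subinput x c))))).
Proof. by []. Qed.

Lemma maj3_subinput1 (y : bits (3 ^ 1)) :
  (fun c => maj3 (subinput y c)) = block y ord0.
Proof.
apply/funext => c; rewrite /= ffunE /block; congr (y _).
by apply: val_inj; rewrite /= expn0; lia.
Qed.

Lemma maj3_contract h (y : bits (3 ^ h.+1)) : maj3 y = maj3 (contract y).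
Proof.
elim: h y => [|h IH] y; first by rewrite maj3S maj3_subinput1 /= ffunE.
rewrite maj3S [RHS]maj3S; congr maj; apply/funext => c.
by rewrite IH contract_subinput.
Qed.

Lemma maj3_subinputS h (y : bits (3 ^ h.+2)) :
  (fun c => maj3 (subinput y c)) = (fun c => maj3 (subinput (contract y) c)).
Proof. by apply/funext => c; rewrite maj3_contract contract_subinput. Qed.

Lemma hard_contract h (y : bits (3 ^ h.+1)) :
  hard y = hard (contract y) && [forall i, nonconst (block y i)].
Proof.
elim: h y => [|h IH] y.
  rewrite hardS maj3_subinput1 /= (_ : [forall c, true]) /=; last exact/forallP.
  by apply/idP/forallP => [yP i|//]; rewrite ord1.
(* The condition at the root is the same on both sides and cancels; the blocks are then distributed
   over the three subtrees. *)
rewrite hardS [hard (contract y)]hardS maj3_subinputS andbAC; congr andb.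
apply/forallP/andP => [yP|[/forallP yP /forallP yN] c].
  split; apply/forallP => c.
    by move: (yP c); rewrite IH contract_subinput => /andP[].
  have [d [i ->]] := subtree_leaf_surj c.
  by move: (yP d); rewrite IH -block_subinput => /andP[_ /forallP].
rewrite IH contract_subinput yP /=; apply/forallP => i.
by rewrite block_subinput.
Qed.

Lemma abs_minority_contract h (y : bits (3 ^ h.+1)) :
  abs_minority y = bottom_leaf (abs_minority (contract y))
                     (minority (block y (abs_minority (contract y)))).
Proof.
elim: h y => [|h IH] y.
  rewrite abs_minorityS maj3_subinput1 /=.
  by apply: val_inj; rewrite /= expn0; lia.
rewrite abs_minorityS [abs_minority (contract y)]abs_minorityS maj3_subinputS.
by rewrite bottom_subtree_leaf IH contract_subinput block_subinput.
Qed.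

(** * Random encodings, their uniformity and the cost of simulation *)

Notation codes h := {ffun 'I_(3 ^ h) -> 'I_3 * bool}.

Definition encode h (e : codes h) (x : bits (3 ^ h)) :
    bits (3 ^ h.+1) :=
  bits_subst (@parent h) (fun j => code (e (parent j)) (position j)) x.

(** The substitution is that of [encode], so this tree on [x] acts as the given tree on
    [encode e x], with known bits answered for free. *)
Definition simulate h (e : codes h) :
    dtree (3 ^ h.+1) -> dtree (3 ^ h) :=
  dtree_subst (@parent h) (fun j => code (e (parent j)) (position j)).

Lemma block_encode h e (x : bits (3 ^ h)) i :
  block (encode e x) i = triple (e i) (x i).
Proof.
apply/funext => c.
by rewrite /block ffunE parent_bottom_leaf position_bottom_leaf.
Qed.

Lemma contract_encode h e (x : bits (3 ^ h)) : contract (encode e x) = x.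
Proof. by apply/ffunP => i; rewrite ffunE block_encode maj_triple. Qed.

Lemma hard_encode h e (x : bits (3 ^ h)) : hard (encode e x) = hard x.
Proof.
rewrite hard_contract contract_encode (_ : [forall i, _] = true) ?andbT //.
by apply/forallP => i; rewrite block_encode nonconst_triple.
Qed.

Lemma abs_minority_encode h e (x : bits (3 ^ h)) (v := abs_minority x) :
  abs_minority (encode e x) = bottom_leaf v (minpos (x v) (e v)).
Proof.
by rewrite abs_minority_contract contract_encode block_encode minority_triple.
Qed.

Lemma queried_simulate h e B (x : bits (3 ^ h)) v :
  v \in queried (simulate e B) x ->
  bottom_leaf v (e v).1 \in queried B (encode e x).
Proof.
rewrite queried_subst => /mapP[j]; rewrite mem_filter => /andP[].
by rewrite code_eq_None => /eqP + + -> => <-; rewrite bottom_leafK.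
Qed.

(** The blocks are coded independently, and each of the [3 ^ h] non-constant blocks has two
    codes. *)
Lemma card_encode_fiber h (y : bits (3 ^ h.+1)) : hard y ->
  #|[pred e | encode e (contract y) == y]| = (2 ^ 3 ^ h)%N.
Proof.
rewrite hard_contract => /andP[_ /forallP yN].
pose F i := [pred e | [forall d, triple e (maj (block y i)) d == block y i d]].
have FE : [pred e | encode e (contract y) == y] =i family F.
  move=> e; rewrite inE; apply/eqP/familyP => [ey i|eF].
    by rewrite inE; apply/forallP => d; rewrite -{2}ey block_encode ffunE.
  apply/ffunP => j; rewrite -(bottom_leafK j).
  rewrite -[LHS]/(block _ _ _) block_encode ffunE.
  by have := eF (parent j); rewrite inE => /forallP/(_ (position j))/eqP.
rewrite (eq_card FE) card_family foldrE big_map /=.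
under eq_bigr do rewrite card_triple //.
by rewrite big_enum /= prod_nat_const card_ord.
Qed.

(** Double counting: an encoding of [x] as [y] forces [x = contract y], and the codes that give a
    hard [y] are equally many for all [y]. The constant 1 yields the cardinalities, query
    probabilities the cost. *)
Lemma sum_encode (V : nmodType) h (F : bits (3 ^ h.+1) -> V) :
  \sum_(x in hard_inputs h) \sum_e F (encode e x) =
  (\sum_(y in hard_inputs h.+1) F y) *+ 2 ^ 3 ^ h.
Proof.
rewrite exchange_big /=.
transitivity (\sum_(e : codes h)
    \sum_(y | (y \in hard_inputs h.+1) && (encode e (contract y) == y)) F y).
  apply: eq_bigr => e _.
  rewrite [RHS](reindex_onto (encode e) (@contract h)); last first.
    by move=> y /andP[_ /eqP].
  by apply: eq_bigl => x; rewrite !inE contract_encode hard_encode !eqxx !andbT.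
rewrite (exchange_big_dep (mem (hard_inputs h.+1))) /=; last first.
  by move=> e y _ /andP[].
rewrite -sumrMnl; apply: eq_bigr => y yH; rewrite yH sumr_const.
by rewrite card_encode_fiber //; rewrite inE in yH.
Qed.

Lemma card_hard_inputsS h :
  (#|hard_inputs h| * #|{: codes h}| =
   #|hard_inputs h.+1| * 2 ^ 3 ^ h)%N.
Proof.
have /eqP := sum_encode (fun _ : bits (3 ^ h.+1) => 1 : int).
rewrite sumr_const -mulrnA.
under eq_bigr do rewrite sumr_const.
by rewrite sumr_const -mulrnA eqr_nat mulnC => /eqP.
Qed.

Lemma hard_inputs_gt0 h : (0 < #|hard_inputs h|)%N.
Proof.
elim: h => [|h /card_gt0P[x]].
  by apply/card_gt0P; exists [ffun=> true]; rewrite inE.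
rewrite inE => xH; apply/card_gt0P; exists (encode [ffun=> (0, true)] x).
by rewrite inE hard_encode.
Qed.

Lemma sum_queried_simulate_le h B (x : bits (3 ^ h)) (v := abs_minority x) :
  (\sum_e (v \in queried (simulate e B) x) <=
   2 * \sum_e (abs_minority (encode e x) \in queried B (encode e x)))%N.
Proof.
pose N (e : codes h) :=
  nat_of_bool (bottom_leaf v (e v).1 \in queried B (encode e x)).
pose M e := nat_of_bool (abs_minority (encode e x) \in queried B (encode e x)).
(* Only the block below the absolute minority [v] is altered. *)
pose sw (e : codes h) : codes h :=
  [ffun i => if i == v then swap_code (x i) (e i) else e i].
have swK : involutive sw.
  move=> e; apply/ffunP => i; rewrite !ffunE.
  by case: eqP => // _; rewrite swap_codeK.
(* The two encodings differ at most in the leaves of [b] and [~~ b] below [v], and these leaves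
   trade roles under [sw]. *)
have NM e : (N e + N (sw e) <= 2 * (M e + M (sw e)))%N.
  rewrite /M /N !abs_minority_encode -/v {2 4}/sw !ffunE eqxx minpos_swap.
  apply: queried_swap_le => i; rewrite -(bottom_leafK i) => ij ik.
  rewrite -!/(block _ _ _) !block_encode ffunE.
  have [iv|//] := eqVneq (parent i) v.
  rewrite iv in ij ik *; rewrite triple_swap //.
    by apply: contraNneq ik => ->.
  by apply: contraNneq ij => ->.
apply: (@leq_trans (\sum_e N e)).
  apply: leq_sum => e _; rewrite /N.
  by case: (boolP (v \in _)) => // /queried_simulate ->.
(* Each sum is doubled and one copy reindexed along [sw], so that [NM] applies termwise. *)
rewrite -/(\sum_e M e)%N -(leq_pmul2l (isT : 0 < 2)%N) !mul2n -!addnn.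
have sumM : (\sum_e M e = \sum_e M (sw e))%N
  by exact: reindex_inj (inv_inj swK).
rewrite {2}(reindex_inj (inv_inj swK)) {2 4}sumM.
by rewrite -big_split -!big_split; apply: leq_sum => e _ /=; have := NM e; lia.
Qed.

(** * Finite mixtures and the induction on the height *)

Lemma sum_uniform_mixture (R : realFieldType) (I E : finType) (w : I -> R)
    (F : I -> E -> R) :
  \sum_p w p.1 / #|E|%:R * F p.1 p.2 =
  (\sum_e \sum_i w i * F i e) / #|E|%:R.
Proof.
rewrite exchange_big -(pair_bigA _ (fun i e => w i / #|E|%:R * F i e)) /=.
rewrite mulr_suml; apply: eq_bigr => i _; rewrite mulr_suml.
by apply: eq_bigr => e _; rewrite mulrAC.
Qed.

(** The index type is arbitrary because the induction replaces [I] by [I * codes h], adding an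
    independent uniform code to the choice of a tree. *)
Lemma finite_mixture_bound (R : realType) h (I : finType) (w : I -> R)
    (t : I -> dtree (3 ^ h)) (delta : R) :
  (forall i, 0 <= w i) -> \sum_i w i = 1 ->
  (forall x, \sum_i w i * (tree_eval (t i) x != maj3 x)%:R <= delta) ->
  (1 - 2 * delta) * 2 ^- h * #|hard_inputs h|%:R <=
  \sum_(x in hard_inputs h)
    \sum_i w i * (abs_minority x \in queried (t i) x)%:R.
Proof.
elim: h I w t => [|h IH] I w t w0 w1 err.
  pose x0 : bits (3 ^ 0) := [ffun=> false].
  pose x1 : bits (3 ^ 0) := [ffun=> true].
  have bitsE : hard_inputs 0 = [set x0; x1]%SET.
    apply/setP => x; rewrite !inE; apply/esym/orP.
    have [xt|xf] := boolP (x ord0); [right|left]; apply/eqP/ffunP => i;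
      by rewrite ffunE ord1 ?xt ?(negPf xf).
  have x01 : x0 != x1 by apply/eqP => /ffunP/(_ ord0); rewrite !ffunE.
  rewrite bitsE cards2 x01 expr0 invr1 mulr1 big_setU1 ?inE //= big_set1.
  pose err_prob x := \sum_i w i * (tree_eval (t i) x != maj3 x)%:R.
  apply: (@le_trans _ _ (2 * \sum_i w i - 2 * (err_prob x0 + err_prob x1))).
    by have : err_prob x0 <= delta := err x0;
       have : err_prob x1 <= delta := err x1; lra.
  rewrite /err_prob -!big_split /= !mulr_sumr -sumrB; apply: ler_sum => i _.
  (* At height 0 a tree either reads the only bit on both inputs, or is constant and errs on exactly
     one of them. *)
  have := w0 i; case: (t i) => [b|j B0 B1] /=; rewrite !ffunE.
    by case: b => /=; lra.
  rewrite !inE (ord1 j) eqxx /=; do 2 case: (_ != _) => /=; lra.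
pose E : finType := codes h.
have E0 : 0 < #|E|%:R :> R.
  by rewrite ltr0n; apply/card_gt0P; exists [ffun=> (0, true)].
pose w' (p : I * E) := w p.1 / #|E|%:R.
pose t' (p : I * E) := simulate p.2 (t p.1).
pose G y := \sum_i w i * (abs_minority y \in queried (t i) y)%:R.
have sumG : \sum_(x in hard_inputs h) \sum_p
      w' p * (abs_minority x \in queried (t' p) x)%:R <=
    2 * ((\sum_(y in hard_inputs h.+1) G y) * (2 ^ 3 ^ h)%:R) / #|E|%:R.
  rewrite mulr_natr -sum_encode mulr_sumr mulr_suml; apply: ler_sum => x _.
  rewrite (sum_uniform_mixture w (fun i e =>
    (abs_minority x \in queried (simulate e (t i)) x)%:R)).
  rewrite ler_pM2r ?invr_gt0 // exchange_big.
  rewrite [X in _ <= _ * X]exchange_big mulr_sumr /=.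
  apply: ler_sum => i _; rewrite -!mulr_sumr mulrCA ler_wpM2l //.
  by rewrite -!natr_sum -natrM ler_nat sum_queried_simulate_le.
have : (1 - 2 * delta) * 2 ^- h * #|hard_inputs h|%:R <=
  2 * ((\sum_(y in hard_inputs h.+1) G y) * (2 ^ 3 ^ h)%:R) / #|E|%:R.
  apply: le_trans sumG; apply: IH => [p||x]; first by rewrite divr_ge0 // ltW.
    under eq_bigr do rewrite -[w' _]mulr1.
    rewrite (sum_uniform_mixture w (fun _ _ => 1)).
    under eq_bigr do under eq_bigr do rewrite mulr1.
    by rewrite w1 sumr_const divff // gt_eqF.
  (* The error of the simulation on [x] is the average over [e] of the original errors on
     [encode e x], which has the same majority value. *)
  rewrite (sum_uniform_mixture w (fun i e =>
    (tree_eval (simulate e (t i)) x != maj3 x)%:R)).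
  rewrite ler_pdivrMr // mulr_natr -sumr_const; apply: ler_sum => e _.
  have := err (encode e x); rewrite maj3_contract contract_encode.
  by under eq_bigr do rewrite -tree_eval_subst.
have K0 : 0 < (2 ^ 3 ^ h)%:R :> R by rewrite ltr0n expn_gt0.
(* The cardinality identity trades the normalisation at height [h] for the one at [h.+1]; the factor
   2 is absorbed by the power of 2. *)
rewrite ler_pdivlMr // -[leLHS]mulrA -natrM card_hard_inputsS natrM !mulrA.
rewrite ler_pM2r //.
by rewrite exprS invfM; lra.
Qed.

Theorem theorem3 (R : realType) (delta : R) (h : nat) :
  0 < delta -> (1 - 2 * delta) * 2 ^- h <= p delta h.
Proof.
move=> /ltW/(p_attained h)[[A /= Ad <-] _].
pose ev (k : bool * bits (3 ^ h)) (B : dtree (3 ^ h)) :=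
  if k.1 then abs_minority k.2 \in queried B k.2
  else tree_eval B k.2 != maj3 k.2.
(* Error and cost involve finitely many events, so [A] can be replaced by a finite mixture giving
   each of them the same probability. *)
have [N [t /(_ R A)[w [w0 w1 wE]]]] := reps_exist ev.
have H0 : 0 < #|hard_inputs h|%:R :> R by rewrite ltr0n hard_inputs_gt0.
rewrite /minority_query_prob [leRHS]mulrC ler_pdivlMr //.
under eq_bigr => x _ do rewrite (wE (true, x)).
apply: finite_mixture_bound => // x.
by rewrite -lee_fin -(wE (false, x)); exact: Ad.
Qed.
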